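(* Let $E$ be a Banach space. (1) Let $K$ be a convex weak$^*$ compact weak$^*$ metrizable subset of $E^*$. Then $$K=\overline{\mathrm{conv}}^{w^*}(w^*\mathrm{Exp}(K)).$$ (2) Let $K$ be a convex weakly compact weakly metrizable subset of $E$. Then $$K=\overline{\mathrm{conv}}^{w}(\mathrm{Exp}(K))=\overline{\mathrm{conv}}^{\|\cdot\|}(\mathrm{Exp}(K)).$$
   Context: Banach spaces are real. For $K\subset E^*$, $w^*\mathrm{Exp}(K)$ is the set of weak$^*$ exposed points of $K$: those $x^*\in K$ for which there is $x\in E$ with $x^*(x)>y^*(x)$ for all $y^*\in K\setminus\{x^*\}$. For $K\subset E$, $\mathrm{Exp}(K)$ is the set of exposed points: those $x\in K$ for which there is $x^*\in E^*$ with $x^*(x)>x^*(y)$ for all $y\in K\setminus\{x\}$. $\overline{\mathrm{conv}}^{w^*}$, $\overline{\mathrm{conv}}^{w}$, $\overline{\mathrm{conv}}^{\|\cdot\|}$ denote the closed convex hulls for the weak$^*$, weak and norm topologies. Metrizability of $K$ refers to the relative weak$^*$ topology in (1) and the relative weak topology in (2). *)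

(* Defs.v *)
From HB Require Import structures.
From mathcomp Require Import all_boot all_order all_algebra.
From mathcomp Require Import all_classical all_reals all_analysis.

Set Implicit Arguments.
Unset Strict Implicit.
Unset Printing Implicit Defensive.

Import Order.TTheory GRing.Theory Num.Theory.
Import numFieldNormedType.Exports.

Local Open Scope classical_set_scope.
Local Open Scope ring_scope.

Section dual_space.
Context {R : realType} {E : normedModType R}.

Definition dual_pred : {pred E -> R^o} :=
  [pred f | `[< linear f /\ continuous f >]].

Lemma dual_pred_submod : submod_closed dual_pred.
Proof.
split.
  apply/asboolP; split; last by move=> x; exact: cvg_cst.
  by move=> a x y; rewrite /= scaler0 addr0.
move=> a f g /asboolP[lf cf] /asboolP[lg cg]; apply/asboolP; split.
  move=> b x y; rewrite !fctE /= lf lg !scalerDr !scalerA [a * b]mulrC.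
  by rewrite addrACA.
by move=> x; apply: cvgD; [apply: cvgZl_tmp; exact: cf | exact: cg].
Qed.

HB.instance Definition _ := GRing.isSubmodClosed.Build R (E -> R^o) dual_pred
  dual_pred_submod.

End dual_space.

(* E^*, as a vector space under the pointwise operations.  No topology is
   attached to [dual E] itself. *)
Record dual (R : realType) (E : normedModType R) : Type := Dual {
  dual_fun :> E -> R^o ;
  dual_funP : dual_fun \in dual_pred
}.

HB.instance Definition _ (R : realType) (E : normedModType R) :=
  [isSub for @dual_fun R E].
HB.instance Definition _ (R : realType) (E : normedModType R) :=
  [Choice of dual E by <:].
HB.instance Definition _ (R : realType) (E : normedModType R) :=
  [SubChoice_isSubLmodule of dual E by <:].

(* Aliases: [weak_star E] and [weak E] are convertible to [dual E] and [E], and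
   carry the coarsest topology making all the evaluations f |-> f x
   (respectively all f in the dual) continuous. *)
Definition weak_star (R : realType) (E : normedModType R) : Type :=
  @sup_topology (dual E) E (fun x => Topological.on
    (initial_topology (fun f : dual E => f x))).

HB.instance Definition _ (R : realType) (E : normedModType R) :=
  Topological.on (weak_star E).

Definition weak (R : realType) (E : normedModType R) : Type :=
  @sup_topology E (dual E) (fun f => Topological.on
    (initial_topology (f : E -> R^o))).

HB.instance Definition _ (R : realType) (E : normedModType R) :=
  Topological.on (weak E).

(* There is a metric on T whose topology is the given one. *)
Definition metrizable (R : realType) (T : topologicalType) : Prop :=
  exists M : Metric R T, @open (Metric.Pack M) = @open T.

(* [set_type] carries the relative topology of the ambient space. *)
Definition weak_star_metrizable (R : realType) (E : normedModType R)
    (K : set (dual E)) : Prop :=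
  metrizable R (set_type (K : set (weak_star E))).

Definition weakly_metrizable (R : realType) (E : normedModType R)
    (K : set E) : Prop :=
  metrizable R (set_type (K : set (weak E))).

Definition weak_star_compact (R : realType) (E : normedModType R)
    (K : set (dual E)) : Prop :=
  compact (K : set (weak_star E)).

Definition weakly_compact (R : realType) (E : normedModType R)
    (K : set E) : Prop :=
  compact (K : set (weak E)).

Definition weak_star_exposed (R : realType) (E : normedModType R)
    (K : set (dual E)) : set (dual E) :=
  [set f | K f /\ exists x : E, forall g, (K `\ f) g -> f x > g x].

Definition exposed (R : realType) (E : normedModType R) (K : set E) : set E :=
  [set x | K x /\ exists f : dual E, forall y, (K `\ x) y -> f x > f y].

Definition convex_hull (R : realType) (M : lmodType R) (A : set M) : set M :=
  smallest (@convex_set R M) A.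

Definition weak_star_closed_conv (R : realType) (E : normedModType R)
    (A : set (dual E)) : set (dual E) :=
  closure (convex_hull A : set (weak_star E)).

Definition weak_closed_conv (R : realType) (E : normedModType R)
    (A : set E) : set E :=
  closure (convex_hull A : set (weak E)).

Definition norm_closed_conv (R : realType) (E : normedModType R)
    (A : set E) : set E :=
  closure (convex_hull A).

(* Main.v *)
Require Import Defs.
From HB Require Import structures.
From mathcomp Require Import all_boot all_order all_algebra.
From mathcomp Require Import all_classical all_reals all_analysis.
From mathcomp Require Import ring lra.

Set Implicit Arguments.
Unset Strict Implicit.
Unset Printing Implicit Defensive.

Import Order.TTheory GRing.Theory Num.Theory.
Import numFieldNormedType.Exports.

Local Open Scope classical_set_scope.
Local Open Scope ring_scope.

(** Both parts are one statement about a pairing between a vector space [V] and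
a family [W] of linear functionals on it: [V] is the dual and [W] the space for
the first part, the other way round for the second.  Let [K] be convex, compact
and metrizable in the topology that [W] induces on [V].

The idea is to put a Hilbert space structure on [K].  Compactness and
metrizability give countably many functionals [w n] separating the points of
[K] ([countably_separated]), and with small enough weights [o n] the formula
  [B u v = \sum_n o n * w n u * w n v]
is an inner product, positive on differences of points of [K], whose square
[B v v] is continuous on [K].  Completeness enters through
[summable_pairing]: the sum [\sum_n o n * w n u * w n] is again a member of
[W], that is, [B u] is one of the available functionals.

Two elementary facts of Euclidean geometry then suffice.  A point of [K]
farthest from a centre [c] is exposed, the exposing functional being
[B (y - c)] ([farthest_point]); and if [q] is the point of a convex set [C]
nearest to [v], then [B (v - q) (z - q) <= 0] on [C] ([nearest_point]).  Suppose
that [v] in [K] is outside [C], the closed convex hull of the exposed points.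
Take [q] in [C] nearest to [v] and centres [c = q - N (v - q)] receding from [v]
along the line through [q] and [v].  The exposed point [y] farthest from [c]
lies in [C], so by the obtuse angle at [q] it satisfies
[|y - c|^2 <= |y - q|^2 + N^2 |v - q|^2], whereas
[|v - c|^2 = (1 + N)^2 |v - q|^2] is larger as soon as [N] is large.  This is
[inner_product_closed_conv_exposed].

The remaining equality, between the weak and the norm closed convex hull, is
Mazur's theorem.  It follows from the Hahn-Banach theorem for convex majorants,
applied to the distance to the convex set, which also shows that the dual
separates points. *)

(** * The Hahn-Banach theorem *)

Section hahn_banach.
Context (R : realType) (V : lmodType R) (p : V -> R).

(** Graphs of linear functionals defined on part of [V] and dominated by [p],
ordered by inclusion: extension of functionals becomes inclusion of sets, the
form in which Zorn's lemma applies directly.  Single-valuedness follows from the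
domination, see [linear_graph_below_fun]. *)
Definition linear_graph_below : set (set (V * R)) :=
  [set G | (forall a x r y s, G (x, r) -> G (y, s) ->
              G (a *: x + y, a * r + s)) /\
           (forall x r, G (x, r) -> r <= p x)].

Hypothesis convex_p : forall x y (a b : R), 0 <= a -> 0 <= b -> a + b = 1 ->
  p (a *: x + b *: y) <= a * p x + b * p y.
Hypothesis p0 : p 0 = 0.

Lemma linear_graph_below0 (G : set (V * R)) z :
  linear_graph_below G -> G z -> G (0, 0).
Proof.
case: z => x r [linG _] Gz.
by have := linG (-1) _ _ _ _ Gz Gz; rewrite scaleN1r addNr mulN1r addNr.
Qed.

(** Two values at one point differ by a value [d] at [0]; by linearity [d * d] is
also a value at [0], hence at most [p 0 = 0]. *)
Lemma linear_graph_below_fun (G : set (V * R)) x r s :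
  linear_graph_below G -> G (x, r) -> G (x, s) -> r = s.
Proof.
move=> GP Gr Gs; have [linG leG] := GP.
have G0 := linear_graph_below0 GP Gr.
have Grs : G (0, r - s).
  have := linG (-1) _ _ _ _ Gs Gr.
  by rewrite scaleN1r addNr mulN1r addrC.
have := leG _ _ (linG (r - s) _ _ _ _ Grs G0).
rewrite scaler0 !addr0 p0 -expr2 => sq_le0.
by apply/eqP; rewrite -subr_eq0 -sqrf_eq0 eq_le sq_le0 sqr_ge0.
Qed.

(** The one-dimensional extension step: [c] is an admissible value at [v].  The
lower bounds on [c] come from moving against [v], the upper bounds from moving
along it, and convexity of [p] on a segment crossing the domain says that every
lower bound is below every upper bound. *)
Lemma linear_graph_below_slope (G : set (V * R)) v : linear_graph_below G ->
  exists c : R, forall x r (t : R), G (x, r) -> r + t * c <= p (x + t *: v).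
Proof.
move=> GP; have [linG leG] := GP.
have [[[x0 r0] G00]|Gempty] := pselect (exists z, G z); last first.
  by exists 0 => x r t Gx; case: Gempty; exists (x, r).
have G0 := linear_graph_below0 GP G00.
have scG a x r : G (x, r) -> G (a *: x, a * r).
  by move=> Gx; have := linG a _ _ _ _ Gx G0; rewrite !addr0.
have addG x r y s : G (x, r) -> G (y, s) -> G (x + y, r + s).
  by move=> Gx Gy; have := linG 1 _ _ _ _ Gx Gy; rewrite scale1r mul1r.
pose L := [set c | exists x r s,
  [/\ G (x, r), 0 < s & c = (r - p (x - s *: v)) / s]].
have key x r y u (s t : R) : G (x, r) -> G (y, u) -> 0 < s -> 0 < t ->
    (r - p (x - s *: v)) / s <= (p (y + t *: v) - u) / t.
  move=> Gx Gy s0 t0; rewrite ler_pdivrMr// mulrAC ler_pdivlMr//.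
  have st0 : s + t != 0 by rewrite gt_eqF// addr_gt0.
  (* With these coefficients the multiples of [v] cancel in the convex
     combination of [x - s *: v] and [y + t *: v]. *)
  pose a := t / (s + t); pose b := s / (s + t).
  have a0 : 0 <= a by rewrite divr_ge0// ?addr_ge0// ltW.
  have b0 : 0 <= b by rewrite divr_ge0// ?addr_ge0// ltW.
  have ab1 : a + b = 1 by rewrite /a /b; field.
  have asbt : a * s = b * t by rewrite /a /b; field.
  have := convex_p (x - s *: v) (y + t *: v) a0 b0 ab1.
  have -> : a *: (x - s *: v) + b *: (y + t *: v) = a *: x + b *: y.
    rewrite scalerBr scalerDr !scalerA asbt addrACA -[in RHS](addr0 (a *: x + _)).
    by congr (_ + _); rewrite addNr.
  move=> /(le_trans (leG _ _ (addG _ _ _ _ (scG a _ _ Gx) (scG b _ _ Gy)))).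
  rewrite /a /b => ineq; have {}ineq :
      (t * r + s * u) / (s + t) <=
      (t * p (x - s *: v) + s * p (y + t *: v)) / (s + t).
    by rewrite !mulrDl !(mulrAC _ _ (s + t)^-1).
  by move: ineq; rewrite ler_pM2r ?invr_gt0 ?addr_gt0//; lra.
have hasL : has_sup L.
  split; first by exists ((0 - p (0 - 1 *: v)) / 1), 0, 0, 1; split.
  exists ((p (0 + 1 *: v) - 0) / 1) => _ [x [r [s [Gx s0 ->]]]].
  exact: key.
exists (sup L) => x r t Gx.
have [t0|t0|->] := ltgtP t 0.
- have s0 : 0 < - t by rewrite oppr_gt0.
  have := sup_upper_bound hasL; move=> /(_ ((r - p (x - (- t) *: v)) / - t)).
  rewrite scaleNr opprK => /(_ _) H.
  have := H _; rewrite ler_pdivrMr// => H'.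
  suff : r - p (x + t *: v) <= sup L * - t by lra.
  by apply: H'; exists x, r, (- t); rewrite scaleNr opprK.
- have : sup L <= (p (x + t *: v) - r) / t.
    apply: ge_sup; first by case: hasL.
    by move=> _ [y [u [s [Gy s0 ->]]]]; exact: key.
  by rewrite ler_pdivlMr//; lra.
- by rewrite mul0r scale0r !addr0; exact: leG.
Qed.

(** The convex, rather than sublinear, form of the theorem spares passing to a
gauge or to directional derivatives when [p] is built from a distance. *)
Theorem hahn_banach : exists f : V -> R^o, linear f /\ forall x, f x <= p x.
Proof.
have [F FP Ftot|G [GP Gmax]] := @Zorn_bigcup _ linear_graph_below.
  split=> [a x r y s [A FA Ax] [B FB By]|x r [A FA Ax]]; last first.
    by have [_] := FP _ FA; apply.
  have [AB|BA] := Ftot _ _ FA FB.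
    by exists B => //; have [linB _] := FP _ FB; apply: linB => //; exact: AB.
  by exists A => //; have [linA _] := FP _ FA; apply: linA => //; exact: BA.
have [linG leG] := GP.
have G0 : G (0, 0).
  apply: contrapT => nG0; apply: (Gmax [set (0, 0)]).
    split=> [z Gz|sub]; first by case: nG0; exact: linear_graph_below0 GP Gz.
    by apply: nG0; exact: sub.
  split=> [a _ _ _ _ [-> ->] [-> ->]|_ _ [-> ->]]; last by rewrite p0.
  by rewrite scaler0 mulr0 !addr0.
have Gtotal v : exists r, G (v, r).
  have [c cP] := linear_graph_below_slope v GP.
  pose G1 := [set z | exists x r (t : R),
    G (x, r) /\ z = (x + t *: v, r + t * c)].
  have G1P : linear_graph_below G1.
    split; last by move=> _ _ [x [r [t [Gx [-> ->]]]]]; exact: cP.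
    move=> a _ _ _ _ [x [r [t [Gx [-> ->]]]]] [y [s [u [Gy [-> ->]]]]].
    exists (a *: x + y), (a * r + s), (a * t + u); split; first exact: linG.
    by congr (_, _); [rewrite scalerDr scalerDl scalerA addrACA | ring].
  have GG1 : G `<=` G1.
    by move=> [x r] Gx; exists x, r, 0; rewrite scale0r mul0r !addr0.
  have [G1G|nG1G] := pselect (G1 `<=` G); last by case: (Gmax G1).
  exists c; apply: G1G; exists 0, 0, 1.
  by rewrite scale1r mul1r !add0r.
have [f fP] := choice Gtotal.
exists f; split=> [a x y|x]; last exact: leG.
exact: linear_graph_below_fun GP (fP _) (linG _ _ _ _ _ (fP x) (fP y)).
Qed.

End hahn_banach.

(** * Convex sets and the separation theorem *)

Lemma convex_setP (R : realType) (M : lmodType R) (A : set M) :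
  convex_set A <-> forall x y (t : R), 0 <= t -> t <= 1 -> A x -> A y ->
    A (t *: x + (1 - t) *: y).
Proof.
split=> [cA x y t t0 t1 /mem_set Ax /mem_set Ay|cA x y t /set_mem Ax /set_mem Ay].
  exact: set_mem (cA _ _ (Itv01 t0 t1) Ax Ay).
apply/mem_set; have := @cA x y t%:num _ _ Ax Ay; apply; [exact: ge0 | exact: le1].
Qed.

Lemma convex_hull_sub (R : realType) (M : lmodType R) (A K : set M) :
  convex_set K -> A `<=` K -> convex_hull A `<=` K.
Proof. by move=> cK AK x; apply. Qed.

Lemma sub_convex_hull (R : realType) (M : lmodType R) (A : set M) :
  A `<=` convex_hull A.
Proof. by move=> x Ax K [_]; apply. Qed.

Lemma convex_hull_convex (R : realType) (M : lmodType R) (A : set M) :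
  convex_set (convex_hull A).
Proof.
apply/convex_setP => x y t t0 t1 Ax Ay K [cK AK].
by move/convex_setP : (cK); apply => //; [exact: Ax | exact: Ay].
Qed.

Lemma dual_linear (R : realType) (E : normedModType R) (f : dual E) : linear f.
Proof. by have /asboolP[] := dual_funP f. Qed.

Lemma dual_continuous (R : realType) (E : normedModType R) (f : dual E) :
  continuous f.
Proof. by have /asboolP[] := dual_funP f. Qed.

Lemma linear_dual (R : realType) (E : normedModType R) (f : E -> R^o) (k : R) :
  linear f -> (forall x, `|f x| <= k * `|x|) ->
  exists g : dual E, forall x, g x = f x.
Proof.
move=> linf fk.
pose F := GRing.isLinear.Build R E R^o *:%R f linf.
pose f' : {linear E -> R^o} := HB.pack f F.
have cf : continuous f.
  apply: (@bounded_linear_continuous _ _ _ f'); apply/linear_boundedP.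
  exists k; split; first exact: num_real.
  move=> r /ltW kr x; apply: (le_trans (fk x)).
  by rewrite ler_wpM2r.
have fP : f \in @dual_pred R E by apply/asboolP.
by exists (Dual fP).
Qed.

Section distance.
Context (R : realType) (E : normedModType R) (C : set E).

Definition set_dist (x : E) : R := inf [set `|x - z| | z in C].

Lemma set_dist_le x z : C z -> set_dist x <= `|x - z|.
Proof.
move=> Cz; apply: inf_lbound; last by exists z.
by exists 0 => _ [? _ <-].
Qed.

Lemma ge_set_dist x r : C !=set0 -> (forall z, C z -> r <= `|x - z|) ->
  r <= set_dist x.
Proof.
move=> [z0 Cz0] rle; apply: lb_le_inf; first by exists `|x - z0|, z0.
by move=> _ [z Cz <-]; exact: rle.
Qed.

(** Averages of near-minimizers in [C] are competitors for the average point. *)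
Lemma set_dist_convex x y (a b : R) : C !=set0 -> convex_set C ->
  0 <= a -> 0 <= b -> a + b = 1 ->
  set_dist (a *: x + b *: y) <= a * set_dist x + b * set_dist y.
Proof.
move=> C0 /convex_setP cC a0 b0 ab1; apply/ler_addgt0Pr => e e0.
have adh u : exists2 z, C z & `|u - z| < set_dist u + e.
  have /(inf_adherent e0)[_ [z Cz <-]] : has_inf [set `|u - z| | z in C].
    split; first by case: C0 => z; exists `|u - z|, z.
    by exists 0 => _ [? _ <-].
  by exists z.
have [z Cz xz] := adh x; have [w Cw yw] := adh y.
have b1 : b = 1 - a by rewrite -ab1 addrC addKr.
have Czw : C (a *: z + b *: w).
  by rewrite b1; apply: cC => //; rewrite -subr_ge0 -b1.
apply: (le_trans (set_dist_le _ Czw)).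
rewrite opprD addrACA -!scalerBr (le_trans (ler_normD _ _))// !normrZ !ger0_norm//.
have -> : a * set_dist x + b * set_dist y + e =
    a * (set_dist x + e) + b * (set_dist y + e).
  by rewrite -[in LHS](mul1r e) -ab1; ring.
by rewrite lerD// ler_wpM2l// ltW.
Qed.

End distance.

(** The functional is a subgradient at [v] of the distance to [C]: it is dominated
by [h |-> dist (v + h) - dist v], which is convex, at most the norm (whence
continuity), and at most [- d] for [h] leading from [v] into [C]. *)
Lemma convex_separation (R : realType) (E : normedModType R) (C : set E) v
    (d : R) : convex_set C -> C !=set0 -> 0 < d ->
    (forall z, C z -> d <= `|v - z|) ->
  exists f : dual E, forall z, C z -> f z + d <= f v.
Proof.
move=> cC C0 d0 dC.
pose p h := set_dist C (v + h) - set_dist C v.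
have p0 : p 0 = 0 by rewrite /p addr0 subrr.
have cp x y (a b : R) : 0 <= a -> 0 <= b -> a + b = 1 ->
    p (a *: x + b *: y) <= a * p x + b * p y.
  move=> a0 b0 ab1; rewrite /p.
  have := set_dist_convex (v + x) (v + y) C0 cC a0 b0 ab1.
  have -> : a *: (v + x) + b *: (v + y) = v + (a *: x + b *: y).
    by rewrite !scalerDr addrACA -scalerDl ab1 scale1r.
  move=> dist_le; have bE : b = 1 - a by rewrite -ab1 addrC addKr.
  by move: dist_le; rewrite bE; lra.
have [f [linf fp]] := hahn_banach cp p0.
have p1 h : p h <= `|h|.
  rewrite /p lerBlDr -lerBlDl; apply: ge_set_dist => // z Cz.
  rewrite lerBlDl; apply: (le_trans (set_dist_le _ Cz)).
  by rewrite addrAC addrC ler_normD.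
have fB := zmod_morphism_linear linf.
have fnorm h : `|f h| <= 1 * `|h|.
  rewrite mul1r ler_norml (le_trans (fp h) (p1 h)) andbT lerNl.
  have <- : f (- h) = - f h.
    by rewrite -[- h]sub0r fB -{1}(subrr 0) fB subrr sub0r.
  by rewrite -normrN (le_trans (fp _) (p1 _)).
have [g gf] := linear_dual linf fnorm.
exists g => z Cz; rewrite !gf.
have dz0 : set_dist C z <= 0 by rewrite -(normr0 E) -(subrr z) set_dist_le.
have dv : d <= set_dist C v by exact: ge_set_dist.
have := fp (z - v); rewrite fB /p subrKC; lra.
Qed.

Lemma dual_separates (R : realType) (E : normedModType R) (x y : E) :
  (forall f : dual E, f x = f y) -> x = y.
Proof.
move=> fxy; apply: contrapT => /eqP xy.
have [||||f /(_ x erefl)] := @convex_separation _ E [set x] y `|y - x|.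
- by apply/convex_setP => _ _ t _ _ -> ->; rewrite -scalerDl subrKC scale1r.
- by exists x.
- by rewrite normr_gt0 subr_eq0 eq_sym.
- by move=> _ ->.
- by move=> H; have := H; rewrite fxy gerDl normr_le0 subr_eq0 eq_sym; apply/negP.
Qed.

(** * Topologies induced by a pairing *)

Lemma continuous_affine (R : realType) (T : topologicalType) (f : T -> R^o)
    (a b : R) : continuous f -> continuous (fun u => a * f u + b : R^o).
Proof.
by move=> cf u; apply: cvgD; [apply: cvgMl_tmp; exact: cf|exact: cvg_cst].
Qed.

(** The common form of the weak and the weak-star topology, so that both reduce to
it by conversion. *)
Definition pairing_topology (R : realType) (V : lmodType R) (W : Type)
    (p : W -> V -> R^o) : Type :=
  @sup_topology V W (fun w => Topological.on (initial_topology (p w))).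

HB.instance Definition _ (R : realType) (V : lmodType R) (W : Type)
    (p : W -> V -> R^o) := Topological.on (pairing_topology p).

Definition pairing_exposed (R : realType) (V : lmodType R) (W : Type)
    (p : W -> V -> R^o) (K : set V) : set V :=
  [set v | K v /\ exists w, forall u, (K `\ v) u -> p w v > p w u].

Section pairing_topology_theory.
Context (R : realType) (V : lmodType R) (W : Type) (p : W -> V -> R^o).
Local Notation T := (pairing_topology p).

Lemma pairing_continuous w : continuous (p w : T -> R^o).
Proof.
move=> v; have /cvg_sup/(_ w) H : nbhs (v : T) --> (v : T) by [].
exact: cvg_trans (cvg_app (p w) H) (@initial_continuous _ _ (p w) v).
Qed.

Lemma continuous_pairing (S : topologicalType) (g : S -> T) :
  (forall w, continuous (p w \o g : S -> R^o)) -> continuous g.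
Proof.
move=> cg s; apply/cvg_sup => w A.
rewrite nbhsE => -[B [[C oC <-] Cs] BA].
apply: filterS BA _; apply: cg.
exact: open_nbhs_nbhs.
Qed.

Hypothesis p_separates : forall u v, (forall w, p w u = p w v) -> u = v.

Lemma pairing_hausdorff : hausdorff_space T.
Proof.
move=> u v uv; apply: p_separates => w.
apply: (@Rhausdorff R) => A B.
move=> /(@pairing_continuous w u) Au /(@pairing_continuous w v) Bv.
by have [x [? ?]] := uv _ _ Au Bv; exists (p w x).
Qed.

Hypothesis p_linear : forall w, linear (p w).

(** The map [u |-> a *: u + b *: z] is continuous for fixed [z], so one endpoint at a
time can be moved from [A] to its closure. *)
Lemma pairing_closure_convex (A : set V) :
  convex_set A -> convex_set (closure (A : set T) : set V).
Proof.
move/convex_setP => cA; apply/convex_setP => x y t t0 t1 clx cly.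
have cont (a b : R) (z : V) : continuous ((fun u => a *: u + b *: z) : T -> T).
  apply: continuous_pairing => w.
  have -> : p w \o (fun u : T => a *: (u : V) + b *: z) =
      fun u : T => a * p w u + b * p w z.
    apply/funext => u' /=.
    by rewrite p_linear (scalable_linear (p_linear w)).
  exact: continuous_affine (@pairing_continuous w).
have closed_step (a b : R) (z : V) :
    (forall u, A u -> closure (A : set T) (a *: u + b *: z)) ->
    forall u, closure (A : set T) u -> closure (A : set T) (a *: u + b *: z).
  move=> sub u; rewrite {1}closureE.
  move=> /(_ ((fun u : T => a *: (u : V) + b *: z : T) @^-1` closure (A : set T))).
  apply; split=> //.
  have /continuous_closedP := cont a b z; apply; exact: closed_closure.
have half u : A u -> closure (A : set T) (t *: x + (1 - t) *: u).
  move=> Au; apply: closed_step clx => x' Ax'.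
  exact/subset_closure/cA.
rewrite addrC; apply: closed_step cly => u Au.
by rewrite addrC; exact: half.
Qed.

End pairing_topology_theory.

Lemma continuous_add_affine (R : realType) (T : topologicalType)
    (f g : T -> R) (a b : R) : continuous f -> continuous g ->
  continuous (fun u => f u + (a * g u + b)).
Proof.
move=> cf cg u; apply: cvgD; first exact: cf.
exact: (continuous_affine cg).
Qed.

(** * Farthest and nearest points for an inner product *)

Section inner_product.
Context (R : realType) (V : lmodType R) (W : Type) (p : W -> V -> R^o).
Local Notation T := (pairing_topology p).
Hypothesis p_linear : forall w, linear (p w).
Hypothesis p_separates : forall u v, (forall w, p w u = p w v) -> u = v.

(** The inner product is given through its Riesz map, so that the functional
[B u] is a member of [W] by construction.  It behaves well only on a subspace
[S] containing [K], outside of which the defining series need not converge. *)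
Variables (K S : set V) (riesz : V -> W).
Local Notation B u v := (p (riesz u) v : R).
Local Notation sq v := (B v v).
Hypothesis K_compact : compact (K : set T).
Hypothesis K_convex : convex_set K.
Hypothesis KS : K `<=` S.
Hypothesis S0 : S 0.
Hypothesis S_linear : forall (a : R) u v, S u -> S v -> S (a *: u + v).
Hypothesis B_sym : forall u v, S u -> S v -> B u v = B v u.
Hypothesis B_pos : forall u v, K u -> K v -> u != v -> 0 < sq (u - v).
Hypothesis sq_continuous : {within (K : set T), continuous (fun v : T => sq v : R)}.

Let S_scale a v : S v -> S (a *: v).
Proof. by move=> Sv; rewrite -[a *: v]addr0; exact: S_linear. Qed.

Let S_add u v : S u -> S v -> S (u + v).
Proof. by move=> Su Sv; rewrite -[u]scale1r; exact: S_linear. Qed.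

Let S_sub u v : S u -> S v -> S (u - v).
Proof. by move=> Su Sv; rewrite addrC -scaleN1r; exact: S_linear. Qed.

Let B_addr u v z : B u (v + z) = B u v + B u z.
Proof. by have := p_linear (riesz u) 1 v z; rewrite !scale1r. Qed.

Let B_scaler a u v : B u (a *: v) = a * B u v.
Proof. exact: scalable_linear (p_linear _) a v. Qed.

Let B_subr u v z : B u (v - z) = B u v - B u z.
Proof. exact: zmod_morphism_linear (p_linear _) v z. Qed.

Let sq_scale a v : S v -> sq (a *: v) = a ^+ 2 * sq v.
Proof.
move=> Sv; rewrite B_scaler (B_sym (S_scale a Sv) Sv) B_scaler; ring.
Qed.

Let sq_add u v : S u -> S v -> sq (u + v) = sq u + 2 * B u v + sq v.
Proof.
move=> Su Sv; have Suv := S_add Su Sv.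
rewrite B_addr (B_sym Suv Su) B_addr (B_sym Suv Sv) B_addr (B_sym Sv Su); ring.
Qed.

Let sq_sub u v : S u -> S v -> sq (u - v) = sq u - 2 * B u v + sq v.
Proof.
move=> Su Sv; rewrite -[- v]scaleN1r sq_add//; last exact: S_scale.
rewrite B_scaler sq_scale//; ring.
Qed.

Let sq_sub_continuous c : S c ->
  {within (K : set T), continuous (fun v : T => sq ((v : V) - c) : R)}.
Proof.
move=> Sc.
apply: (@subspace_eq_continuous _ _ _
  (fun v : T => sq v + ((- 2) * B c v + sq c) : R)).
  move=> v /set_mem Kv; have Sv := KS Kv.
  by rewrite -[RHS]/(sq ((v : V) - c)) sq_sub// (B_sym Sv Sc); ring.
apply: continuous_add_affine sq_continuous _.
exact/continuous_subspaceT/pairing_continuous.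
Qed.

(** If [z] in [K] is another point, then [|z - c| <= |y - c|] and
[z - c = (y - c) - (y - z)] give [2 B (y - c) (y - z) >= |y - z|^2 > 0]. *)
Lemma farthest_point c : S c -> K !=set0 ->
  exists2 y, pairing_exposed p K y & forall z, K z -> sq (z - c) <= sq (y - c).
Proof.
move=> Sc K0.
have [y /set_mem Ky ymax] :=
  @compact_EVT_max T R _ K K0 K_compact (sq_sub_continuous Sc).
have {}ymax z : K z -> sq (z - c) <= sq (y - c) by move=> /mem_set; exact: ymax.
exists y => //; split=> //; exists (riesz (y - c)) => z [Kz /eqP zy].
have [Sy Sz] := (KS Ky, KS Kz).
rewrite eq_sym in zy.
have := ymax z Kz; have := B_pos Ky Kz zy.
have -> : z - c = (y - c) - (y - z) by rewrite opprB [RHS]addrC subrKA.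
by rewrite (sq_sub (S_sub Sy Sc) (S_sub Sy Sz)) (B_subr (y - c) y z); lra.
Qed.

(** Otherwise a short move from [q] towards [z], which stays in [C], would come
closer to [v]. *)
Lemma nearest_point (C : set V) v q z : convex_set C -> C `<=` S -> S v ->
    C q -> (forall z, C z -> sq (q - v) <= sq (z - v)) -> C z ->
  B (v - q) (z - q) <= 0.
Proof.
move=> /convex_setP cC CS Sv Cq qmin Cz.
have [Sq Sz] := (CS _ Cq, CS _ Cz).
have [Svq Szq] := (S_sub Sv Sq, S_sub Sz Sq).
have step t : 0 < t -> t <= 1 -> 2 * B (v - q) (z - q) <= t * sq (z - q).
  move=> t0 t1; have := qmin _ (cC _ _ _ (ltW t0) t1 Cz Cq).
  have -> : t *: z + (1 - t) *: q - v = t *: (z - q) - (v - q).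
    by rewrite scalerBl scale1r scalerBr opprB -!addrA [q + (_ + _)]addrCA.
  rewrite (sq_sub (S_scale t Szq) Svq) (B_sym (S_scale t Szq) Svq) (B_scaler t (v - q)).
  rewrite (sq_scale t Szq) -(opprB v q) -(scaleN1r (v - q)) (sq_scale _ Svq).
  rewrite sqrrN expr1n mul1r lerDr => le0.
  have : 0 <= t * (t * sq (z - q) - 2 * B (v - q) (z - q)) by nra.
  by rewrite pmulr_rge0// subr_ge0.
rewrite leNgt; apply/negP => B0.
have := step 1 ltr01 (lexx _); rewrite mul1r => B_le.
have s0 : 0 < sq (z - q) by lra.
(* The step minimizing the distance to [v] along the line from [q] to [z]. *)
have := step (B (v - q) (z - q) / sq (z - q)) (divr_gt0 B0 s0).
by rewrite ler_pdivrMr// divfK ?gt_eqF//; lra.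
Qed.

Theorem inner_product_closed_conv_exposed :
  K = closure (convex_hull (pairing_exposed p K) : set T).
Proof.
set A := convex_hull _; set C := closure _.
have CK : C `<=` K.
  have /closure_id -> : closed (K : set T).
    exact: compact_closed (pairing_hausdorff p_separates) K_compact.
  by apply: closureS; apply: convex_hull_sub => // x [].
apply/seteqP; split=> // v Kv; apply: contrapT => nCv.
have Sv := KS Kv.
have K0 : K !=set0 by exists v.
have C0 : (C : set T) !=set0.
  have [y expy _] := farthest_point S0 K0; exists y.
  exact: (@subset_closure T A y (sub_convex_hull expy)).
have C_compact : compact C.
  exact: subclosed_compact (@closed_closure _ _) K_compact CK.
have cC : convex_set (C : set V).
  by apply: pairing_closure_convex => //; exact: convex_hull_convex.
have [q /set_mem Cq qmin] := compact_EVT_min C0 C_compact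
  (continuous_subspaceW CK (sq_sub_continuous Sv)).
have Kq := CK _ Cq; have Sq := KS Kq.
have obtuse z : C z -> B (v - q) (z - q) <= 0.
  move=> Cz; apply: (nearest_point cC) => // [u /CK /KS//|u Cu].
  by apply: qmin; exact/mem_set.
have vq : v != q by apply/eqP => vq; apply: nCv; rewrite vq.
have d0 := B_pos Kv Kq vq; set d := sq (v - q) in d0.
have [y0 _ y0max] := farthest_point Sq K0; set L := sq (y0 - q) in y0max.
have Svq := S_sub Sv Sq.
have L0 : 0 <= L by have := y0max _ Kq; rewrite B_subr subrr.
(* Any [N] with [(1 + 2 * N) * d > L] serves; [L] bounds the squared distance
   from [q] over [K]. *)
pose N := L / d.
have Sc : S (q - N *: (v - q)) by exact: S_sub Sq (S_scale _ Svq).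
have [y expy ymax] := farthest_point Sc K0.
have Ky : K y by case: expy.
have Syq : S (y - q) by exact: S_sub (KS Ky) Sq.
have Cy : C y by exact: (@subset_closure T A y (sub_convex_hull expy)).
have split_at z : z - (q - N *: (v - q)) = (z - q) + N *: (v - q).
  by rewrite opprB addrA addrAC.
have := ymax _ Kv; rewrite !split_at.
have -> : v - q + N *: (v - q) = (1 + N) *: (v - q) by rewrite scalerDl scale1r.
rewrite (sq_add Syq (S_scale N Svq)) !sq_scale// -/d.
rewrite (B_scaler N (y - q)) (B_sym Syq Svq).
have N0 : 0 <= N by rewrite divr_ge0// ltW.
have NB : N * B (v - q) (y - q) <= 0 by rewrite mulr_ge0_le0// obtuse.
have yL : sq (y - q) <= N * d.
  by rewrite /N divfK ?gt_eqF//; exact: y0max.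
nra.
Qed.

End inner_product.

(** * Metrizable compact sets *)

Lemma compact_set_type (T : topologicalType) (K : set T) :
  compact K -> compact [set: set_type K].
Proof.
move=> cK F FF _.
have [|p [Kp clp]] := cK (set_val @ F) _.
  by apply: (@filterS _ F _ setT) filterT => x _; exact: set_valP.
exists (SigSub (mem_set Kp)); split=> // A B FA [G' [[G oG <-] Gp GB]].
have FA' : (set_val @ F) (set_val @` A).
  by apply: (@filterS _ F _ A) FA => x Ax; exists x.
have [_ [[x Ax <-] Gx]] := clp _ _ FA' (open_nbhs_nbhs (conj oG Gp)).
by exists x; split=> //; exact: GB.
Qed.

Lemma compact_metrizable_second_countable (R : realType) (T : topologicalType)
    (x0 : T) : metrizable R T -> compact [set: T] -> @second_countable T.
Proof.
move=> [M openM] cT.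
pose X : metricType R := Metric.Pack M.
have nbhsM (x : T) : @nbhs X X x = @nbhs T T x.
  by rewrite !nbhsE /open_nbhs -openM.
pose P := isPointed.Build (X : Type) x0.
pose pX : pseudoPMetricType R := HB.pack (X : Type) X P.
have cX : compact [set: pX].
  move=> F FF FT; have [x [_ clx]] := cT F FF FT.
  exists x; split=> // A B FA; rewrite (nbhsM x); exact: clx.
have [B cB [Bopen Bnbhs]] := compact_second_countable cX.
exists B => //; split; first by rewrite -openM.
by move=> x A; rewrite -nbhsM; exact: Bnbhs.
Qed.

Section countable_separation.
Context (R : realType) (V : lmodType R) (W : Type) (p : W -> V -> R^o).
Local Notation T := (pairing_topology p).
Hypothesis p_separates : forall u v, (forall w, p w u = p w v) -> u = v.

(** For every pair of basic open sets separated by some functional, keep one such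
functional.  Two points with distinct values under some functional have basic
neighbourhoods separated by it, hence are separated by the one that was kept. *)
Lemma countably_separated (w0 : W) (K : set V) :
    @second_countable (set_type (K : set T)) ->
  exists w : nat -> W, forall u v, K u -> K v ->
    (forall n, p (w n) u = p (w n) v) -> u = v.
Proof.
set X := set_type _ => -[B /countable_injP[g ginj] [Bopen Bnbhs]].
pose sep w (U U' : set X) := exists a : R,
  (forall x, U x -> p w (set_val x) < a) /\ (forall x, U' x -> a < p w (set_val x)).
have /choice[w wP] n : exists w, forall U U', B U -> B U' ->
    pickle (g U, g U') = n -> (exists w', sep w' U U') -> sep w U U'.
  have [[U [U' [BU BU' <- [w' sepw']]]]|none] := pselect (exists U U',
      [/\ B U, B U', pickle (g U, g U') = n & exists w', sep w' U U']).
    exists w' => U1 U1' BU1 BU1' /(pcan_inj pickleK)[gU gU'] _.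
    by rewrite (ginj _ _ _ _ gU) ?inE// (ginj _ _ _ _ gU') ?inE.
  (* An index coding no separated pair. *)
  by exists w0 => U U' BU BU' gUU' ex; case: none; exists U, U'.
exists w => u v Ku Kv uv; apply: p_separates => z; apply: contrapT.
have nlt x y : K x -> K y -> (forall n, p (w n) x = p (w n) y) ->
    ~ (p z x < p z y).
  move=> Kx Ky xy zxy; pose a : R := (p z x + p z y) / 2.
  pose x' : X := SigSub (mem_set Kx); pose y' : X := SigSub (mem_set Ky).
  have pz : continuous (fun t : X => p z (set_val t)).
    move=> t; apply: (@continuous_comp X T R^o set_val (p z)).
      exact: initial_continuous.
    exact: pairing_continuous.
  have [U [BU Ux] Ua] : filter_from [set U | B U /\ U x'] id
      [set t | p z (set_val t) < a].
    apply: Bnbhs; apply: (pz x' [set r | r < a]); apply: lt_nbhsl.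
    rewrite /a /x' /=; lra.
  have [U' [BU' Uy] Ua'] : filter_from [set U | B U /\ U y'] id
      [set t | a < p z (set_val t)].
    apply: Bnbhs; apply: (pz y' [set r | a < r]); apply: lt_nbhsr.
    rewrite /a /y' /=; lra.
  have [] := wP _ U U' BU BU' erefl; first by exists z, a.
  move=> b [/(_ _ Ux) + /(_ _ Uy)] /=.
  by rewrite xy => /lt_trans /[apply]; rewrite ltxx.
move=> /eqP; rewrite neq_lt => /orP[]; apply: nlt => //.
Qed.

End countable_separation.

(** * The inner product of a metrizable compact set *)

(** The Weierstrass test for nonnegative terms: the remainder of index [n] is at most
[2 * 2^-1 ^+ n], because partial sums increase to the limit while partial sums
plus this bound decrease to it. *)
Lemma dominated_series_continuous (R : realType) (T : topologicalType)
    (K : set T) (f : nat -> T -> R) (g : T -> R) :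
  (forall n, continuous (f n)) ->
  (forall n x, K x -> 0 <= f n x <= 2^-1 ^+ n) ->
  (forall x, K x -> series (f ^~ x) @ \oo --> g x) ->
  {within K, continuous g}.
Proof.
move=> cf fh fg.
have tail n x : K x -> `|g x - series (f ^~ x) n| <= 2 * 2^-1 ^+ n.
  move=> Kx; have cvgf := fg x Kx.
  have ndecr : nondecreasing_seq (series (f ^~ x)).
    apply/nondecreasing_seqP => m; rewrite seriesSr lerDl.
    by have /andP[] := fh m x Kx.
  have le_g : series (f ^~ x) n <= g x.
    rewrite -(cvg_lim (@Rhausdorff R) cvgf); apply: nondecreasing_cvgn_le => //.
    by apply/cvg_ex; exists (g x).
  pose s m : R := series (f ^~ x) m + 2 * 2^-1 ^+ m.
  have sg : s @ \oo --> g x.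
    rewrite -[g x]addr0; apply: cvgD => //.
    rewrite -(mulr0 2); apply: cvgMl_tmp; apply: cvg_expr.
    by rewrite ger0_norm ?invr_ge0// invf_lt1// ltr1n.
  have nincr : nonincreasing_seq s.
    apply/nonincreasing_seqP => m; rewrite /s seriesSr exprS.
    have /andP[_] := fh m x Kx; lra.
  have : g x <= s n.
    rewrite -(cvg_lim (@Rhausdorff R) sg); apply: nonincreasing_cvgn_ge => //.
    by apply/cvg_ex; exists (g x).
  by rewrite ger0_norm ?subr_ge0// /s; lra.
apply: (@uniform_limit_continuous_subspace T R K
  ((fun n x => series (f ^~ x) n) @ \oo)).
  suff : \forall n \near \oo, continuous
    ((fun x => series (f ^~ x) n) : subspace K -> R) by [].
  apply: nearW => n; apply: continuous_subspaceT.
  elim: n => [|n IHn] x.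
    have -> : (fun x => series (f ^~ x) 0) = cst 0.
      by apply/funext => y; rewrite /series/= big_geq.
    exact: cvg_cst.
  have -> : (fun x => series (f ^~ x) n.+1) =
      (fun x => series (f ^~ x) n + f n x).
    by apply/funext => y; rewrite seriesSr.
  by apply: cvgD; [exact: IHn|exact: cf].
move=> P /uniform_nbhs[E [entE subP]].
move: entE; rewrite -entourage_ballE => -[e /= e0 ballE].
have /cvgrPdist_lt/(_ e e0) : (fun n => 2 * 2^-1 ^+ n : R) @ \oo --> (0 : R).
  rewrite -(mulr0 2); apply: cvgMl_tmp; apply: cvg_expr.
  by rewrite ger0_norm ?invr_ge0// invf_lt1// ltr1n.
apply: filterS => n; rewrite sub0r normrN => small; apply: subP => y Ky.
apply: ballE; rewrite /ball/=.
apply: le_lt_trans (tail n y Ky) _.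
exact: le_lt_trans (ler_norm _) small.
Qed.

(** The only trace of completeness in the argument: series with small enough
coefficients can be summed inside the family of functionals.  The sizes [c n]
play the role of [2^-n] divided by the norm of [w n], without reference to a
norm on [W]. *)
Definition summable_pairing (R : realType) (V W : Type) (p : W -> V -> R^o) :=
  forall w : nat -> W, exists2 c : nat -> R, forall n, 0 < c n &
    forall (a : nat -> R) (k : R), (forall n, `|a n| <= k * c n) ->
      exists r : W, forall v,
        series (fun n => a n * p (w n) v : R) @ \oo --> (p r v : R).

Lemma continuous_scaled_sqr (R : realType) (T : topologicalType) (f : T -> R)
    (a : R) : continuous f -> continuous (fun x => a * f x * f x).
Proof.
by move=> cf x; apply: cvgM; [apply: cvgMl_tmp|]; exact: cf.
Qed.

Section metrizable_compact.
Context (R : realType) (V : lmodType R) (W : Type) (p : W -> V -> R^o).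
Local Notation T := (pairing_topology p).
Hypothesis p_linear : forall w, linear (p w).
Hypothesis p_separates : forall u v, (forall w, p w u = p w v) -> u = v.

Lemma compact_pairing_bounded (K : set V) (w : W) : compact (K : set T) ->
  exists M : R, forall v, K v -> `|p w v| <= M.
Proof.
move=> cK; have [K0|Kempty] := pselect (K !=set0); last first.
  by exists 0 => v Kv; case: Kempty; exists v.
have cnorm : continuous (fun v : T => `|p w v| : R).
  move=> v; apply: (@continuous_comp T R R (p w) Num.norm).
    exact: pairing_continuous.
  exact: norm_continuous.
have [v _ vmax] := @compact_EVT_max T R _ K K0 cK (continuous_subspaceT cnorm).
by exists `|p w v| => u Ku; apply: vmax; exact/mem_set.
Qed.

(** Here the inner product is constructed.  The weights [o n] have to meet two
demands: [o n * M n ^+ 2 <= 2^-1 ^+ n], where [M n] bounds [w n] on [K], makes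
[B v v] a uniformly convergent series on [K]; and [o n * M n <= c n] lets
[summable_pairing] represent [B u] for every [u] in the subspace [S] of
vectors whose coordinates are of the order of [M n]. *)
Theorem metrizable_closed_conv_exposed (K : set V) : W -> summable_pairing p ->
  convex_set K -> compact (K : set T) -> metrizable R (set_type (K : set T)) ->
  K = closure (convex_hull (pairing_exposed p K) : set T).
Proof.
move=> w0 p_summable K_convex K_compact K_metrizable.
have [[x0 Kx0]|Kempty] := pselect (K !=set0); last first.
  have hull0 : convex_hull (pairing_exposed p K) `<=` K.
    by apply: convex_hull_sub => // x [].
  have K0 : K = set0 by apply/seteqP; split=> // x Kx; case: Kempty; exists x.
  rewrite {1}K0 (_ : convex_hull _ = set0) ?closure0//.
  by apply/seteqP; split=> // x /hull0; rewrite K0.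
have [w w_separates] := countably_separated p_separates w0
  (@compact_metrizable_second_countable R (set_type (K : set T))
     (SigSub (mem_set Kx0)) K_metrizable (compact_set_type K_compact)).
have [c c_gt0 c_summable] := p_summable w.
have /choice[M0 M0P] n := compact_pairing_bounded (w n) K_compact.
(* Since [1 <= M n], a bound on [o n * M n ^+ 2] is one on [o n * M n] too. *)
pose M n := 1 + `|M0 n|.
have M_ge1 n : 1 <= M n by rewrite lerDl.
have M_gt0 n : 0 < M n by exact: lt_le_trans ltr01 (M_ge1 n).
have MP n v : K v -> `|p (w n) v| <= M n.
  move=> /(M0P n)/le_trans; apply; rewrite /M.
  by apply: (le_trans (ler_norm _)); rewrite lerDr.
pose o n := Num.min 1 (c n) * 2^-1 ^+ n / M n ^+ 2.
have h_gt0 n : 0 < 2^-1 ^+ n :> R by rewrite exprn_gt0// invr_gt0.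
have h_le1 n : 2^-1 ^+ n <= 1 :> R.
  by rewrite exprn_ile1// ?invr_ge0// invf_le1// ler1n.
have o_gt0 n : 0 < o n.
  rewrite /o !mulr_gt0// ?invr_gt0 ?exprn_gt0// lt_min ltr01/=; exact: c_gt0.
have o_M2 n : o n * M n ^+ 2 <= 2^-1 ^+ n.
  rewrite /o divfK ?gt_eqF ?exprn_gt0//.
  by rewrite ler_piMl ?(ltW (h_gt0 n))// ge_min lexx.
have o_M n : o n * M n <= c n.
  apply: (@le_trans _ _ (o n * M n ^+ 2)).
    by rewrite ler_wpM2l ?(ltW (o_gt0 n))// expr2 ler_peMl ?(ltW (M_gt0 n)).
  rewrite /o divfK ?gt_eqF ?exprn_gt0//.
  apply: (@le_trans _ _ (Num.min 1 (c n))); last by rewrite ge_min lexx orbT.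
  by rewrite ler_piMr// le_min ler01 ltW.
pose S := [set v | exists k : R, forall n, `|p (w n) v| <= k * M n].
have /choice[riesz rieszP] u : exists r, S u -> forall v,
    series (fun n => o n * p (w n) u * p (w n) v : R) @ \oo --> (p r v : R).
  have [[k uk]|nSu] := pselect (S u); last by exists w0 => /nSu.
  have [|r rP] := c_summable (fun n => o n * p (w n) u) k; last by exists r.
  move=> n; rewrite normrM (gtr0_norm (o_gt0 n)).
  have k_ge0 : 0 <= k.
    by have := le_trans (normr_ge0 _) (uk 0%N); rewrite pmulr_lge0.
  apply: (@le_trans _ _ (o n * (k * M n))).
    by rewrite ler_wpM2l// ltW.
  by rewrite mulrCA ler_wpM2l.
have S_linear (a : R) u v : S u -> S v -> S (a *: u + v).
  move=> [k uk] [l vl]; exists (`|a| * k + l) => n.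
  rewrite p_linear (le_trans (ler_normD _ _))// mulrDl lerD//.
  by rewrite normrM -mulrA ler_wpM2l.
have KS : K `<=` S by move=> v Kv; exists 1 => n; rewrite mul1r; exact: MP.
apply: (@inner_product_closed_conv_exposed R V W p
  p_linear p_separates K S riesz) => //.
- exists 0 => n; rewrite mul0r.
  by rewrite -(subrr x0) (zmod_morphism_linear (p_linear (w n))) subrr normr0.
 - move=> u v Su Sv.
  apply: (cvg_unique (@Rhausdorff R) (rieszP u Su v)).
  rewrite (_ : (fun n => _) = fun n => o n * p (w n) v * p (w n) u).
    exact: rieszP.
  by apply/funext => n; rewrite mulrAC.
- move=> u v Ku Kv uv.
  have Suv : S (u - v) by rewrite addrC -scaleN1r; apply: S_linear; exact: KS.
  have [n wn] : exists n, p (w n) (u - v) != 0.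
    apply: contrapT => no; move/eqP: uv; apply; apply: w_separates => // n.
    apply/eqP; rewrite -subr_eq0 -(zmod_morphism_linear (p_linear (w n))).
    by apply: contrapT => /negP wn; apply: no; exists n.
  have := rieszP _ Suv (u - v).
  set f := fun n => _ => cvgf.
  have f_ge0 m : 0 <= f m.
    by rewrite /f -mulrA -expr2 mulr_ge0 ?sqr_ge0 ?(ltW (o_gt0 m)).
  have ndecr : nondecreasing_seq (series f).
    by apply/nondecreasing_seqP => m; rewrite seriesSr lerDl.
  apply: (@lt_le_trans _ _ (series f n.+1)).
    rewrite seriesSr ltr_wpDl ?sumr_ge0//.
    by rewrite /f -mulrA -expr2 mulr_gt0// lt_neqAle sqr_ge0 eq_sym sqrf_eq0 wn.
  rewrite -(cvg_lim (@Rhausdorff R) cvgf); apply: nondecreasing_cvgn_le => //.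
  by apply/cvg_ex; eexists; exact: cvgf.
- apply: (@dominated_series_continuous R T K
    (fun n v => o n * p (w n) v * p (w n) v)).
  + move=> n; apply: (@continuous_scaled_sqr R T (p (w n) : T -> R) (o n)).
    exact: pairing_continuous.
  + move=> n v Kv.
    rewrite -mulrA -expr2 mulr_ge0 ?sqr_ge0 ?(ltW (o_gt0 n))//=.
    apply: le_trans (o_M2 n); rewrite ler_wpM2l ?(ltW (o_gt0 n))//.
    by rewrite -real_normK ?num_real// lerXn2r ?nnegrE ?MP// ltW.
  + by move=> v /KS Sv; exact: rieszP.
Qed.

End metrizable_compact.

(** * The two pairings of a Banach space with its dual *)

Lemma geometric_series_cvg (R : realType) (F : completeNormedModType R)
    (u : nat -> F) (M : R) :
  (forall n, `|u n| <= M * 2^-1 ^+ n) ->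
  cvgn (series u) /\ `|limn (series u)| <= 2 * M.
Proof.
move=> uM.
have half1 : `|2^-1 : R| < 1.
  by rewrite ger0_norm ?invr_ge0// invf_lt1// ltr1n.
have geoM := @cvg_geometric_series R M 2^-1 half1.
have cgeo : cvgn (series (geometric M 2^-1)) by exact: cvgP geoM.
have cnorm : cvgn [normed series u].
  apply: series_le_cvg cgeo => [n|n|n] /=; [by []| |exact: uM].
  exact: le_trans (normr_ge0 _) (uM n).
split; first exact: normed_cvg.
apply: (le_trans (lim_series_norm cnorm)).
apply: (le_trans (lim_series_le cnorm cgeo uM)).
rewrite (cvg_lim (@Rhausdorff R) geoM).
have -> : 1 - 2^-1 = 2^-1 :> R by field.
by rewrite invrK mulrC.
Qed.

(** Absolutely convergent series in a Banach space converge, and evaluation at their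
sum is the sum of the evaluations, by continuity. *)
Lemma summable_evaluation (R : realType) (E : completeNormedModType R) :
  summable_pairing (fun (x : E) (f : dual E) => f x).
Proof.
move=> x; exists (fun n => 2^-1 ^+ n / (1 + `|x n|)) => [n|a k ak].
  by rewrite divr_gt0 ?exprn_gt0 ?invr_gt0// ltr_pwDl.
have [|cx _] := @geometric_series_cvg R E (fun n => a n *: x n) k.
  move=> n; rewrite normrZ; have x_gt0 : 0 < 1 + `|x n| by rewrite ltr_pwDl.
  apply: (@le_trans _ _ (`|a n| * (1 + `|x n|))).
    by rewrite ler_wpM2l// lerDr.
  by rewrite -ler_pdivlMr// -mulrA.
exists (limn (series (fun n => a n *: x n))) => f.
have fseries n : series (fun n => a n * f (x n) : R) n =
    f (series (fun n => a n *: x n) n).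
  have f0 : f 0 = 0.
    by rewrite -(subrr 0) (zmod_morphism_linear (dual_linear f)) subrr.
  elim: n => [|n IHn]; first by rewrite /series/= !big_geq.
  rewrite !seriesSr IHn.
  by rewrite [X in _ = f X]addrC dual_linear addrC.
rewrite (_ : series _ = f \o series (fun n => a n *: x n)); last exact/funext.
apply: cvg_comp cx _; exact: dual_continuous.
Qed.

Lemma dual_bounded (R : realType) (E : normedModType R) (f : dual E) :
  exists2 C : R, 0 <= C & forall x, `|f x| <= C * `|x|.
Proof.
pose F := GRing.isLinear.Build R E R^o *:%R f (dual_linear f).
pose f' : {linear E -> R^o} := HB.pack (f : E -> R^o) F.
have /linear_bounded_continuous/linear_boundedP/pinfty_ex_gt0[C C0 fC] :
  continuous f' by exact: dual_continuous.
by exists C; [exact: ltW | exact: fC].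
Qed.

(** The series of functionals converges pointwise, with sum bounded by a multiple of
the norm of the argument. *)
Lemma summable_dual (R : realType) (E : normedModType R) :
  summable_pairing (fun (f : dual E) (x : E) => f x).
Proof.
move=> f.
have /choice[C CP] n : exists C : R, 0 <= C /\ forall x, `|f n x| <= C * `|x|.
  by have [C C0 fC] := dual_bounded (f n); exists C.
have C_gt0 n : 0 < 1 + C n by have [C0 _] := CP n; rewrite ltr_pwDl.
exists (fun n => 2^-1 ^+ n / (1 + C n)) => [n|a k ak].
  by rewrite divr_gt0 ?exprn_gt0 ?invr_gt0.
pose u x n : R^o := a n * f n x.
have uP x n : `|u x n| <= (k * `|x|) * 2^-1 ^+ n.
  have [C0 fC] := CP n; rewrite normrM.
  apply: (@le_trans _ _ (`|a n| * ((1 + C n) * `|x|))).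
    rewrite ler_wpM2l// (le_trans (fC x))// ler_wpM2r// lerDr//.
  rewrite [leLHS]mulrA [leRHS]mulrAC ler_wpM2r//.
  by rewrite -ler_pdivlMr// -mulrA.
pose s x := limn (series (u x)).
have sP x : series (u x) @ \oo --> s x.
  by have [] := geometric_series_cvg (uP x).
have s_linear : linear s.
  move=> b x y; apply: (cvg_lim (@Rhausdorff R)).
  have -> : series (u (b *: x + y)) = b *: series (u x) + series (u y).
    apply/funext => n; rewrite /series/= !fctE/= scaler_sumr -big_split/=.
    apply: eq_bigr => i _; rewrite /u dual_linear.
    by rewrite /GRing.scale/=; ring.
  by apply: cvgD; [apply: cvgZl_tmp|]; exact: sP.
have [g gs] : exists g : dual E, forall x, g x = s x.
  apply: (@linear_dual _ _ s (2 * k)) => // x; rewrite -mulrA.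
  by have [] := geometric_series_cvg (uP x).
by exists g => x; rewrite gs; exact: sP.
Qed.

(** Mazur's theorem: a point off the norm closure of a convex set is separated from
it by a functional, hence also lies off its weak closure. *)
Lemma weak_closed_convE (R : realType) (E : normedModType R) (A : set E) :
  weak_closed_conv A = norm_closed_conv A.
Proof.
apply/seteqP; split=> x clx; last first.
  move=> U; have wc : continuous (id : E -> weak E).
    apply: (@continuous_pairing R E (dual E) (fun f x => f x)) => f.
    exact: dual_continuous.
  by move=> /(wc x); exact: clx.
have [[y Ay]|A0] := pselect (convex_hull A !=set0); last first.
  by have [y [Ay _]] := clx setT filterT; case: A0; exists y.
apply: contrapT => nclx.
have [U /nbhs_ballP[d /= d0 dU] UA] :
    exists2 U, nbhs x U & ~ (convex_hull A `&` U !=set0).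
  by move/existsNP : nclx => [U /not_implyP[? ?]]; exists U.
have [|||z Az|f fsep] := @convex_separation R E (convex_hull A) x d.
- exact: convex_hull_convex.
- by exists y.
- by [].
- rewrite leNgt; apply/negP => zd; apply: UA; exists z; split=> //.
  by apply: dU; rewrite -ball_normE.
have fc := @pairing_continuous R E (dual E) (fun f x => f x) f.
have [] := clx ((fun z => f z : R) @^-1` [set r | f x - d < r]).
  by apply: (fc x [set r | f x - d < r]); apply: lt_nbhsr; rewrite gtrBl.
by move=> z [/fsep]; rewrite -lerBrDr leNgt => /negP.
Qed.

(** * Exposed points of weak-star and weakly compact sets *)

Theorem corollary3 (R : realType) (E : completeNormedModType R) :
  (forall K : set (dual E),
      convex_set K -> weak_star_compact K -> weak_star_metrizable K ->
      K = weak_star_closed_conv (weak_star_exposed K)) /\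
  (forall K : set E,
      convex_set K -> weakly_compact K -> weakly_metrizable K ->
      K = weak_closed_conv (exposed K) /\
      weak_closed_conv (exposed K) = norm_closed_conv (exposed K)).
Proof.
split=> K K_convex K_compact K_metrizable.
  apply: (@metrizable_closed_conv_exposed R (dual E) E (fun x f => f x)) => //.
  - by move=> f g fg; apply/val_inj/funext.
  - exact: 0.
  - exact: summable_evaluation.
split; last exact: weak_closed_convE.
apply: (@metrizable_closed_conv_exposed R E (dual E) (fun f x => f x)) => //.
- exact: dual_linear.
- exact: dual_separates.
- exact: 0.
- exact: summable_dual.
Qed.
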